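(* Let $B(X,Y)$ be a clean bipartite graph in which every vertex is an end of at least one arc ($B(X,Y)$ need not be weakly connected). Then $$B(X,Y)\cong \mathrm{VRSP}\bigl(B(X,Y)/Y,\;B(X,Y)/X\bigr).$$
   Context: **Graphs.** A graph $G$ is a finite edge-labelled acyclic directed multigraph: a vertex set $V(G)$, an arc set $A(G)$, a set $L(G)$ of label pairs (the label pairs carried by arcs of $G$), an incidence map $\mu:A(G)\to V(G)\times V(G)$, where $\mu(a)=(u,v)$ means that $a$ has tail $u$ and head $v$ (its two ends), and a labelling $\lambda:A(G)\to L(G)$, where $\lambda(a)=(\ell(a),t(a))$ consists of a string $\ell(a)$ and a positive real $t(a)$. Two different arcs with the same tail and the same head are assumed to have different label pairs; whenever a construction produces several arcs with the same tail, head and label pair, they are replaced by a single one. **Levels.** $S^0(G)$ is the set of vertices of in-degree $0$; $S^1(G)$ is the set of vertices of in-degree $0$ after deleting $S^0(G)$ and all arcs with tail in $S^0(G)$; and so on. A vertex in $S^j(G)$ is at level $j$. In particular, level $0$ means in-degree $0$. **Arcs between sets.** For disjoint nonempty $X,Y\subseteq V(G)$, $[X,Y]$ is the set of arcs with one end in $X$ and the other in $Y$; such an arc is forward if its head is in $Y$ and backward otherwise. The subgraph arc-induced by a set $A'$ of arcs has arc set $A'$ and as vertices the ends of arcs of $A'$. **Clean bipartite graphs.** A graph is bipartite, written $B(V_1,V_2)$, if its vertex set is partitioned into nonempty sets $V_1,V_2$ such that every arc has its ends in different sets. It is complete if for all $x\in V_1$, $y\in V_2$ there is an arc with $\mu(a)=(x,y)$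 or $\mu(a)=(y,x)$. $B(V_1,V_2)$ is clean if (i) for every label pair occurring on its arcs, the subgraph arc-induced by all arcs with that label pair is a complete bipartite graph $B(V_1',V_2')$ with $V_1'\subseteq V_1$, $V_2'\subseteq V_2$, and (ii) $[V_1,V_2]$ has no backward arcs or $[V_1,V_2]$ has no forward arcs. **Contraction.** For a nonempty proper subset $X$ of $V(G)$, $G/X$ is obtained by replacing $X$ by a new vertex $\tilde x$, deleting all arcs with both ends in $X$, and replacing each arc with exactly one end in $X$ by an arc with the same label pair in which that end is replaced by $\tilde x$. **Products.** Let $G_1,G_2$ be graphs. An arc $a$ of $G_1$ is synchronising with respect to $G_2$ if some arc $b$ of $G_2$ has $\lambda(b)=\lambda(a)$; similarly with the roles exchanged. The Cartesian product $G_1\,\Box\,G_2$ has vertex set $V(G_1)\times V(G_2)$; each arc $a\in A(G_1)$ with $\mu(a)=(v_1,w_1)$ and each $v_2\in V(G_2)$ give an arc from $(v_1,v_2)$ to $(w_1,v_2)$ with label pair $\lambda(a)$, and each arc $a\in A(G_2)$ with $\mu(a)=(v_2,w_2)$ and each $v_1\in V(G_1)$ give an arc from $(v_1,v_2)$ to $(v_1,w_2)$ with label pair $\lambda(a)$. The intermediate product $G_1\boxtimes G_2$ has the same vertex set; its arcs are the arcs of $G_1\,\Box\,G_2$ arising from non-synchronising arcs of $G_1$ or $G_2$ (label pair not in $L(G_2)$, respectively $L(G_1)$), together with, for each pair $a_1\in A(G_1)$, $a_2\in A(G_2)$ with $\lambda(a_1)=\lambda(a_2)$, $\mu(a_1)=(v_1,w_1)$,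 $\mu(a_2)=(v_2,w_2)$, an arc from $(v_1,v_2)$ to $(w_1,w_2)$ with label pair $\lambda(a_1)$. The vertex-removing synchronised product $\mathrm{VRSP}(G_1,G_2)$ is obtained from $G_1\boxtimes G_2$ by removing every vertex that has level $0$ in the current graph but level $>0$ in $G_1\,\Box\,G_2$, together with all arcs with that vertex as tail, and repeating this until no such vertices remain. **Isomorphism.** $G\cong H$ means there is a bijection $\phi:V(G)\to V(H)$ such that for all $u,v\in V(G)$ and every label pair, there is an arc $a\in A(G)$ with $\mu(a)=(u,v)$ and that label pair if and only if there is an arc $b\in A(H)$ with $\mu(b)=(\phi(u),\phi(v))$ and that label pair. *)

(* Defs.v *)
From HB Require Import structures.
From Stdlib Require Ascii String.
From mathcomp Require Import all_boot all_order all_algebra.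
From mathcomp Require Import reals.

Set Implicit Arguments.
Unset Strict Implicit.
Unset Printing Implicit Defensive.

Lemma string_codeK :
  cancel (fun s => map Ascii.nat_of_ascii (String.list_ascii_of_string s))
         (fun t => String.string_of_list_ascii (map Ascii.ascii_of_nat t)).
Proof.
move=> s; rewrite -map_comp (eq_map (g := id)) => [|c /=].
  by rewrite map_id String.string_of_list_ascii_of_string.
by rewrite Ascii.ascii_nat_embedding.
Qed.

HB.instance Definition _ :=
  Countable.copy String.string (can_type string_codeK).

Definition label_pair (R : realType) : Type :=
  (String.string * {t : R | (0 < t)%R})%type.

HB.instance Definition _ (R : realType) := Choice.on (label_pair R).

(* The vertex set V(G) is a subset of an ambient finite type V, so that deleting
   vertices stays within [graph R V]. Acyclicity is the separate predicate
   [acyclic], because contracting a set of vertices of an acyclic graph may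
   create a directed cycle. *)
Record graph (R : realType) (V : finType) := Graph {
  vset : {set V};
  arcT : finType;
  mu : arcT -> V * V;
  lam : arcT -> label_pair R;
  mu_vset : forall a, ((mu a).1 \in vset) && ((mu a).2 \in vset);
  arc_inj : forall a b, mu a = mu b -> lam a = lam b -> a = b
}.

Section Graphs.
Variables (R : realType) (V : finType).
Implicit Types (G H : graph R V) (X Y : {set V}).

Definition arc_tail G (a : arcT G) : V := (mu a).1.
Definition arc_head G (a : arcT G) : V := (mu a).2.

Definition label_set G : seq (label_pair R) := [seq lam a | a : arcT G].

Definition adj G : rel V := fun u v => [exists a : arcT G, mu a == (u, v)].

Definition acyclic G : Prop :=
  forall c : seq V, c != [::] -> ~~ cycle (adj G) c.

(* Each triple (tail, head, label pair) is one arc, however often it is listed: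
   this is the replacement of equal parallel arcs by a single one. Triples with
   an end outside W are dropped, which matters only when deleting vertices. *)
Section OfTriples.
Variables (W : {set V}) (s : seq (V * V * label_pair R)).

Definition triples_in : seq (V * V * label_pair R) :=
  [seq e <- s | (e.1.1 \in W) && (e.1.2 \in W)].

Lemma of_triples_vset (e : seq_sub triples_in) :
  ((ssval e).1.1 \in W) && ((ssval e).1.2 \in W).
Proof. by have := ssvalP e; rewrite mem_filter => /andP[]. Qed.

Lemma of_triples_inj (e f : seq_sub triples_in) :
  (ssval e).1 = (ssval f).1 -> (ssval e).2 = (ssval f).2 -> e = f.
Proof.
move=> e1 e2; apply/val_inj.
by rewrite /= [ssval e]surjective_pairing e1 e2 -surjective_pairing.
Qed.

Definition of_triples : graph R V :=
  {| vset := W; arcT := seq_sub triples_in;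
     mu := fun e => (ssval e).1; lam := fun e => (ssval e).2;
     mu_vset := of_triples_vset; arc_inj := of_triples_inj |}.
End OfTriples.

Definition delete_vertices G X : graph R V :=
  of_triples (vset G :\: X) [seq (mu a, lam a) | a : arcT G].

Definition in_degree G (v : V) : nat := #|[set a : arcT G | arc_head a == v]|.

Definition sources G : {set V} := [set v in vset G | in_degree G v == 0].

(* S^j(G); sources have no incoming arcs, so only arcs out of them get deleted
   along with them. *)
Definition level_set G (j : nat) : {set V} :=
  sources (iter j (fun H => delete_vertices H (sources H)) G).

(* The j with v \in S^j(G). In an acyclic graph there is exactly one, and it is
   less than #|vset G|; a vertex in no S^j(G) gets the default #|vset G|. *)
Definition level G (v : V) : nat :=
  find (fun j => v \in level_set G j) (iota 0 #|vset G|).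

(* [X, Y], for disjoint nonempty X and Y. *)
Definition arcs_between G X Y : {set arcT G} :=
  [set a : arcT G | (arc_tail a \in X) && (arc_head a \in Y)
                || (arc_tail a \in Y) && (arc_head a \in X)].

Definition forward_arcs G X Y : {set arcT G} :=
  [set a in arcs_between G X Y | arc_head a \in Y].

Definition backward_arcs G X Y : {set arcT G} :=
  [set a in arcs_between G X Y | arc_head a \notin Y].

Definition arc_induced G (A : {set arcT G}) : graph R V :=
  of_triples ([set arc_tail a | a in A] :|: [set arc_head a | a in A])
             [seq (mu a, lam a) | a in A].

Definition bipartite G X Y : Prop :=
  [/\ X != set0, Y != set0, [disjoint X & Y], X :|: Y = vset G
    & forall a : arcT G, a \in arcs_between G X Y].

Definition complete_bipartite G X Y : Prop :=
  bipartite G X Y /\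
  forall x y, x \in X -> y \in Y ->
    exists a : arcT G, mu a = (x, y) \/ mu a = (y, x).

Definition clean_bipartite G X Y : Prop :=
  [/\ bipartite G X Y,
      forall l, l \in label_set G ->
        exists X' Y' : {set V},
          [/\ X' \subset X, Y' \subset Y
            & complete_bipartite (arc_induced [set a : arcT G | lam a == l])
                                 X' Y']
    & backward_arcs G X Y = set0 \/ forward_arcs G X Y = set0].

End Graphs.

(* G / X; the new vertex is [None]. *)
Definition contract (R : realType) (V : finType) (G : graph R V) (X : {set V}) :
    graph R (option V) :=
  let c v := if v \in X then None else Some v in
  of_triples (None |: [set Some v | v in vset G :\: X])
    [seq ((c (arc_tail a), c (arc_head a)), lam a)
       | a in [pred a : arcT G
                | ~~ ((arc_tail a \in X) && (arc_head a \in X))]].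

Definition synchronising (R : realType) (V1 V2 : finType)
    (G1 : graph R V1) (G2 : graph R V2) (a : arcT G1) : bool :=
  [exists b : arcT G2, lam b == lam a].

Section Products.
Variables (R : realType) (V1 V2 : finType).
Variables (G1 : graph R V1) (G2 : graph R V2).

Definition left_arcs (P : pred (arcT G1)) :
    seq ((V1 * V2) * (V1 * V2) * label_pair R) :=
  [seq (((arc_tail a, v), (arc_head a, v)), lam a)
     | a <- enum P, v <- enum (vset G2)].

Definition right_arcs (P : pred (arcT G2)) :
    seq ((V1 * V2) * (V1 * V2) * label_pair R) :=
  [seq (((v, arc_tail a), (v, arc_head a)), lam a)
     | a <- enum P, v <- enum (vset G1)].

Definition sync_arcs : seq ((V1 * V2) * (V1 * V2) * label_pair R) :=
  [seq (((arc_tail p.1, arc_tail p.2), (arc_head p.1, arc_head p.2)), lam p.1)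
     | p in [pred p : arcT G1 * arcT G2 | lam p.1 == lam p.2]].

Definition cartesian_product : graph R (V1 * V2)%type :=
  of_triples (setX (vset G1) (vset G2)) (left_arcs predT ++ right_arcs predT).

Definition intermediate_product : graph R (V1 * V2)%type :=
  of_triples (setX (vset G1) (vset G2))
    (left_arcs (fun a => ~~ synchronising G2 a)
     ++ right_arcs (fun a => ~~ synchronising G1 a) ++ sync_arcs).

Definition vrsp_step (H : graph R (V1 * V2)%type) : graph R (V1 * V2)%type :=
  delete_vertices H
    [set v in vset H | (level H v == 0) && (0 < level cartesian_product v)].

(* Each effective step removes a vertex, so after #|vset| steps none is left to
   remove. *)
Definition VRSP : graph R (V1 * V2)%type :=
  iter #|vset intermediate_product| vrsp_step intermediate_product.

End Products.

Definition isomorphic (R : realType) (V W : finType)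
    (G : graph R V) (H : graph R W) : Prop :=
  exists phi : {v | v \in vset G} -> {w | w \in vset H},
    bijective phi /\
    forall u v l,
      (exists a : arcT G, mu a = (val u, val v) /\ lam a = l) <->
      (exists b : arcT H, mu b = (val (phi u), val (phi v)) /\ lam b = l).

(* Main.v *)
Require Import Defs.
From mathcomp Require Import all_boot all_order all_algebra.
From mathcomp Require Import reals.

Set Implicit Arguments.
Unset Strict Implicit.
Unset Printing Implicit Defensive.

(** Write cY and cX for the two contraction maps of B(X, Y), so that cY sends
    Y to the new vertex and fixes X, and cX does the opposite.  The isomorphism
    is v |-> (cY v, cX v): a vertex x of X goes to (x, x~) and a vertex y of Y
    to (y~, y).

    Every label pair of B occurs in both contractions, so every arc
    synchronises, and an arc of the intermediate product comes from two arcs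
    u -> v and u' -> v' of B with the same label pair l.  All arcs of B point
    the same way between X and Y, and the arcs labelled l form a complete
    bipartite graph, so u -> v' and u' -> v with label pair l are arcs of B as
    well, and the product arc is the image of one of these two.  Hence the arcs
    of the intermediate product are exactly the images of the arcs of B
    ([intermediate_arcsE]).

    The remaining vertices (x, y) and (y~, x~) have no incoming arc there, but
    they have one in the Cartesian product, so the first round of vertex removal
    deletes them.  The image of a vertex of B that is a head keeps its incoming
    arcs, and the image of a vertex that is only a tail already has level 0 in
    the Cartesian product; so nothing else is ever deleted ([VRSP_stable]). *)

(** [has_arc G u v l]: some arc of G goes from u to v with label pair l.  As
    parallel arcs have distinct label pairs, this relation and the vertex set
    determine G up to renaming its arcs. *)
Definition has_arc (R : realType) (V : finType) (G : graph R V) (u v : V)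
    (l : label_pair R) : Prop :=
  exists a : arcT G, mu a = (u, v) /\ lam a = l.

(** * Arcs and levels of the constructions *)

Section Arcs.
Variables (R : realType) (V : finType).
Implicit Types (G : graph R V) (u v : V) (l : label_pair R).

Lemma has_arc_vset G u v l : has_arc G u v l -> u \in vset G /\ v \in vset G.
Proof. by case=> a [mu_a _]; have := mu_vset a; rewrite mu_a => /andP[]. Qed.

Lemma mem_triples G u v l :
  reflect (has_arc G u v l) ((u, v, l) \in [seq (mu a, lam a) | a : arcT G]).
Proof.
apply: (iffP mapP) => [[a _ [uv ->]]|[a [<- <-]]]; first by exists a.
by exists a; rewrite ?mem_enum.
Qed.

Lemma has_arc_of_triples (W : {set V}) (s : seq (V * V * label_pair R)) u v l :
  has_arc (of_triples W s) u v l <->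
  [/\ (u, v, l) \in s, u \in W & v \in W].
Proof.
split=> [[e [/= mu_e lam_e]]|[s_uvl Wu Wv]].
  have := ssvalP e; rewrite mem_filter [ssval e]surjective_pairing mu_e lam_e.
  by case/andP=> /= /andP[Wu Wv] s_uvl.
have uvl_in: (u, v, l) \in triples_in W s by rewrite mem_filter /= Wu Wv.
by exists (SeqSub uvl_in).
Qed.

Lemma has_arc_delete G (D : {set V}) u v l :
  has_arc (delete_vertices G D) u v l <->
  [/\ has_arc G u v l, u \notin D & v \notin D].
Proof.
rewrite has_arc_of_triples !inE; split.
  by case=> /mem_triples Guvl /andP[-> _] /andP[-> _].
case=> Guvl -> ->; have [-> ->] := has_arc_vset Guvl.
by split=> //; apply/mem_triples.
Qed.

Lemma has_arc_induced G (l : label_pair R) u v l' :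
  has_arc (arc_induced [set a : arcT G | lam a == l]) u v l' <->
  has_arc G u v l /\ l' = l.
Proof.
rewrite has_arc_of_triples; split.
  case=> /mapP[a]; rewrite mem_enum inE => /eqP lam_a [mu_a ->] _ _.
  by split=> //; exists a.
case=> [[a [mu_a lam_a]]] ->; rewrite !inE.
have Aa: a \in [set a : arcT G | lam a == l] by rewrite inE lam_a.
split; first by apply/mapP; exists a; rewrite ?mem_enum ?mu_a ?lam_a.
  by apply/orP; left; apply/imsetP; exists a; rewrite // /arc_tail mu_a.
by apply/orP; right; apply/imsetP; exists a; rewrite // /arc_head mu_a.
Qed.

Lemma sourcesP G v : v \in vset G ->
  reflect (forall u l, ~ has_arc G u v l) (v \in sources G).
Proof.
move=> Gv; rewrite !inE Gv /= cards_eq0.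
apply: (iffP eqP) => [in0 u l [a [mu_a _]]|no_in].
  by have := in_set0 a; rewrite -in0 inE /arc_head mu_a eqxx.
apply/setP=> a; rewrite !inE; apply/negP=> /eqP a_v.
by apply: (no_in (arc_tail a) (lam a)); exists a; rewrite -a_v -surjective_pairing.
Qed.

Lemma level_eq0 G v : v \in vset G -> (level G v == 0) = (v \in sources G).
Proof.
move=> Gv; rewrite /level.
have: 0 < #|vset G| by apply/card_gt0P; exists v.
by case: #|vset G| => //= n _; rewrite /level_set /=; case: ifP.
Qed.

End Arcs.

(** The contraction map v |-> v~ of G / Z, with [None] for the new vertex. *)
Definition contract_map (V : finType) (Z : {set V}) (v : V) : option V :=
  if v \in Z then None else Some v.

Lemma contract_map_vset (R : realType) (V : finType) (G : graph R V)
    (Z : {set V}) v :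
  v \in vset G -> contract_map Z v \in vset (contract G Z).
Proof.
rewrite /contract_map => Gv; case: ifPn => Zv; rewrite /= !inE //=.
by apply/imsetP; exists v; rewrite // inE Zv.
Qed.

Lemma has_arc_contract (R : realType) (V : finType) (G : graph R V)
    (Z : {set V}) p q l :
  has_arc (contract G Z) p q l <->
  exists u v, [/\ has_arc G u v l, ~~ ((u \in Z) && (v \in Z)),
                  p = contract_map Z u & q = contract_map Z v].
Proof.
rewrite has_arc_of_triples; split.
  case=> /mapP[a]; rewrite mem_enum inE => Za [-> -> ->] _ _.
  exists (arc_tail a), (arc_head a); split=> //.
  by exists a; rewrite -surjective_pairing.
case=> u [v [Guvl Zuv -> ->]]; have [Gu Gv] := has_arc_vset Guvl.
split; [|exact: contract_map_vset..].
case: Guvl => a [mu_a <-]; apply/mapP; exists a.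
  by rewrite mem_enum inE /arc_tail /arc_head mu_a.
by rewrite /arc_tail /arc_head mu_a.
Qed.

Section Products.
Variables (R : realType) (V1 V2 : finType).
Variables (G1 : graph R V1) (G2 : graph R V2).
Implicit Types (p q : V1 * V2) (l : label_pair R).

Lemma mem_left_arcs (P : pred (arcT G1)) p q l :
  (p, q, l) \in left_arcs G2 P ->
  exists2 a, P a & mu a = (p.1, q.1) /\ lam a = l.
Proof.
case/allpairsP=> -[a v] /= [Pa _ [-> -> ->]]; exists a.
  by move: Pa; rewrite mem_enum.
by rewrite -surjective_pairing.
Qed.

Lemma mem_right_arcs (P : pred (arcT G2)) p q l :
  (p, q, l) \in right_arcs G1 P ->
  exists2 a, P a & mu a = (p.2, q.2) /\ lam a = l.
Proof.
case/allpairsP=> -[a v] /= [Pa _ [-> -> ->]]; exists a.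
  by move: Pa; rewrite mem_enum.
by rewrite -surjective_pairing.
Qed.

Lemma mem_sync_arcs p q l :
  (p, q, l) \in sync_arcs G1 G2 <->
  has_arc G1 p.1 q.1 l /\ has_arc G2 p.2 q.2 l.
Proof.
split=> [/mapP[[a b]]|[[a [mu_a lam_a]] [b [mu_b lam_b]]]].
  rewrite mem_enum inE /= => /eqP lam_ab [-> -> ->].
  by split; [exists a | exists b]; rewrite -surjective_pairing.
apply/mapP; exists (a, b); first by rewrite mem_enum inE /= lam_a lam_b.
rewrite /= /arc_tail /arc_head mu_a mu_b lam_a /=.
by rewrite -!surjective_pairing.
Qed.

Lemma has_arc_cartesian p q l :
  has_arc (cartesian_product G1 G2) p q l ->
  has_arc G1 p.1 q.1 l \/ has_arc G2 p.2 q.2 l.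
Proof.
case/has_arc_of_triples; rewrite mem_cat.
by case/orP=> [/mem_left_arcs|/mem_right_arcs] [a _ aP] _ _;
  [left | right]; exists a.
Qed.

Lemma has_arc_cartesian_left u v w l :
  has_arc G1 u v l -> w \in vset G2 ->
  has_arc (cartesian_product G1 G2) (u, w) (v, w) l.
Proof.
move=> G1uv G2w; have [G1u G1v] := has_arc_vset G1uv.
apply/has_arc_of_triples; rewrite !inE G1u G1v G2w mem_cat; split=> //.
case: G1uv => a [mu_a <-]; apply/orP; left; apply/allpairsP; exists (a, w).
by rewrite !mem_enum /= /arc_tail /arc_head mu_a.
Qed.

Lemma has_arc_cartesian_right u v w l :
  has_arc G2 u v l -> w \in vset G1 ->
  has_arc (cartesian_product G1 G2) (w, u) (w, v) l.
Proof.
move=> G2uv G1w; have [G2u G2v] := has_arc_vset G2uv.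
apply/has_arc_of_triples; rewrite !inE G2u G2v G1w mem_cat; split=> //.
case: G2uv => a [mu_a <-]; apply/orP; right; apply/allpairsP; exists (a, w).
by rewrite !mem_enum /= /arc_tail /arc_head mu_a.
Qed.

(** When all arcs synchronise, the intermediate product is the synchronous
    (tensor) product. *)
Lemma has_arc_intermediate p q l :
    (forall a : arcT G1, synchronising G2 a) ->
    (forall b : arcT G2, synchronising G1 b) ->
  has_arc (intermediate_product G1 G2) p q l <->
  has_arc G1 p.1 q.1 l /\ has_arc G2 p.2 q.2 l.
Proof.
move=> sync1 sync2; rewrite has_arc_of_triples !mem_cat; split.
  case=> /or3P[/mem_left_arcs[a]|/mem_right_arcs[a]|/mem_sync_arcs //].
    by rewrite /= sync1.
  by rewrite /= sync2.
case=> arc1 arc2; have [p1 q1] := has_arc_vset arc1.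
have [p2 q2] := has_arc_vset arc2; rewrite !inE p1 q1 p2 q2; split=> //.
by apply/or3P/Or33/mem_sync_arcs.
Qed.

(** A criterion for the removal process to stop after one round, with the set W
    of vertices left.  One round suffices because a vertex of W that has an
    incoming arc keeps one from W. *)
Lemma VRSP_stable (W : {set V1 * V2}) :
  let I := intermediate_product G1 G2 in
  let C := cartesian_product G1 G2 in
    vset I != set0 ->
    W \subset vset I ->
    (forall q, q \in W -> (forall p l, ~ has_arc C p q l) \/
       exists2 p, p \in W & exists l, has_arc I p q l) ->
    (forall q, q \in vset I :\: W ->
       (forall p l, ~ has_arc I p q l) /\ exists p l, has_arc C p q l) ->
  vset (VRSP G1 G2) = W /\
  forall p q l, has_arc (VRSP G1 G2) p q l <->
    [/\ has_arc I p q l, p \in W & q \in W].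
Proof.
move=> I C I_n0 sWI Win Wout.
pose good H := vset H = W /\
  forall p q l, has_arc H p q l <-> [/\ has_arc I p q l, p \in W & q \in W].
(* Both the initial graph and every later one satisfy these assumptions on H,
   so one lemma serves the first round and all the following ones. *)
have step H : W \subset vset H -> vset H \subset vset I ->
    (forall p q l, has_arc H p q l <->
       [/\ has_arc I p q l, p \in vset H & q \in vset H]) ->
    good (vrsp_step G1 G2 H).
  move=> sWH sHI HP.
  have remE q : q \in vset H ->
      (level H q == 0) && (0 < level C q) = (q \notin W).
    move=> Hq; have Iq := subsetP sHI _ Hq.
    rewrite lt0n level_eq0 // level_eq0 //.
    have [Wq|W'q] := boolP (q \in W).
      apply/negP=> /andP[/(sourcesP Hq) H0 C'q].
      case: (Win q Wq) => [C0|[p Wp [l Ipq]]].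
        by case/negP: C'q; apply/(sourcesP (G := C) Iq).
      apply: (H0 p l).
      by apply/HP; split=> //; exact: (subsetP sWH).
    have [|I0 [p [l Cpq]]] := Wout q; first by rewrite inE W'q.
    apply/andP; split; first by apply/(sourcesP Hq) => p' l' /HP[/I0].
    by apply/negP=> /(sourcesP (G := C) Iq) C0; apply: (C0 p l).
  have memD q : q \in vset H ->
      (q \notin [set v in vset H | (level H v == 0) && (0 < level C v)])
      = (q \in W).
    by move=> Hq; rewrite inE Hq remE // negbK.
  split=> [|p q l].
    apply/setP=> q; rewrite in_setD; case Hq: (q \in vset H).
      by rewrite andbT memD.
    by rewrite andbF; apply/esym/negP => /(subsetP sWH); rewrite Hq.
  rewrite /vrsp_step has_arc_delete; split.
    case=> Hpq; have [Hp Hq] := has_arc_vset Hpq; rewrite !memD // => Wp Wq.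
    by case/HP: Hpq.
  case=> Ipq Wp Wq; have [Hp Hq] := (subsetP sWH _ Wp, subsetP sWH _ Wq).
  by split; rewrite ?memD //; apply/HP.
rewrite -/(good (VRSP G1 G2)) /VRSP.
have: 0 < #|vset I| by rewrite card_gt0.
rewrite -/I; case: #|vset I| => // n _; elim: n => [|n [Wn arcn]] /=.
  apply: step => // p q l; split=> [Ipq|[]//].
  by have [Ip Iq] := has_arc_vset Ipq.
by apply: step; rewrite -/(iter n.+1 _ _) ?Wn.
Qed.

End Products.

(** * Clean bipartite graphs *)

Section Clean.
Variables (R : realType) (V : finType) (B : graph R V) (X Y : {set V}).
Hypothesis B_clean : clean_bipartite B X Y.

Lemma clean_disjoint v : v \in X -> v \in Y -> False.
Proof.
by case: B_clean => [[_ _ /pred0P dXY _ _] _ _] Xv Yv; have := dXY v;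
  rewrite /= Xv Yv.
Qed.

Lemma clean_vset v : v \in vset B -> (v \in Y) = (v \notin X).
Proof.
case: B_clean => [[_ _ _ <- _] _ _]; rewrite inE.
case Xv: (v \in X) => //= _; apply/negP; exact: clean_disjoint.
Qed.

Lemma clean_oriented :
  (forall u v l, has_arc B u v l -> u \in X /\ v \in Y) \/
  (forall u v l, has_arc B u v l -> u \in Y /\ v \in X).
Proof.
case: B_clean => [[_ _ _ _ between] _ [no_back|no_fwd]]; [left|right].
  move=> u v l [a [mu_a _]]; have := between a; have := in_set0 a.
  rewrite -no_back !inE /arc_tail /arc_head mu_a /=.
  case Yv: (v \in Y) => /=; last by rewrite andbT => ->.
  rewrite andbT => _ /orP[//|/andP[_ Xv]].
  by case: (clean_disjoint Xv Yv).
move=> u v l [a [mu_a _]]; have := between a; have := in_set0 a.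
rewrite -no_fwd !inE /arc_tail /arc_head mu_a /=.
case Yv: (v \in Y) => /=; first by rewrite !andbT => ->.
by rewrite !andbF => _ /andP[].
Qed.

(** The arcs with a given label pair form a rectangle tails x heads. *)
Lemma clean_rectangle u v u' v' l :
  has_arc B u v l -> has_arc B u' v' l -> has_arc B u v' l.
Proof.
move=> Buv Buv'.
have lB: l \in label_set B.
  by case: Buv => a [_ <-]; apply/mapP; exists a; rewrite ?mem_enum.
have [_ /(_ _ lB) [X' [Y' [sX sY [[_ _ _ HE _] compl]]]] _] := B_clean.
have arcH w z : has_arc B w z l -> w \in X' :|: Y' /\ z \in X' :|: Y'.
  move=> Bwz; rewrite HE; apply: (has_arc_vset (l := l)).
  exact/has_arc_induced.
have memX' w : w \in X' :|: Y' -> w \in X -> w \in X'.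
  rewrite inE => /orP[//|/(subsetP sY) Yw] Xw.
  by case: (clean_disjoint Xw Yw).
have memY' w : w \in X' :|: Y' -> w \in Y -> w \in Y'.
  rewrite inE => /orP[/(subsetP sX) Xw Yw|//].
  by case: (clean_disjoint Xw Yw).
have arcXY x y : x \in X' -> y \in Y' -> has_arc B x y l \/ has_arc B y x l.
  move=> X'x Y'y; pose H := arc_induced [set a : arcT B | lam a == l].
  have [a [mu_a|mu_a]] := compl x y X'x Y'y; [left|right].
    by have /has_arc_induced[]: has_arc H x y (@lam _ _ H a) by exists a.
  by have /has_arc_induced[]: has_arc H y x (@lam _ _ H a) by exists a.
have [[Hu _] [_ Hv']] := (arcH _ _ Buv, arcH _ _ Buv').
case: clean_oriented => dir.
  have [[Xu _] [_ Yv']] := (dir _ _ _ Buv, dir _ _ _ Buv').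
  case: (arcXY u v') => //; [exact: memX' | exact: memY' |].
  by move/dir=> [_ Yu]; case: (clean_disjoint Xu).
have [[Yu _] [_ Xv']] := (dir _ _ _ Buv, dir _ _ _ Buv').
case: (arcXY v' u) => //; [exact: memX' | exact: memY' |].
by move/dir=> [_ Xu]; case: (clean_disjoint Xu).
Qed.

Lemma contract_map_side u v : u \in vset B -> v \in vset B ->
  contract_map Y u = contract_map Y v \/ contract_map X u = contract_map X v ->
  (u \in X) = (v \in X).
Proof.
move=> Bu Bv; rewrite /contract_map !clean_vset //.
case Xu: (u \in X); case Xv: (v \in X) => //=; by case.
Qed.

(** Bipartiteness makes contraction of one class lose no arc. *)
Lemma has_arc_contract_class (Z : {set V}) p q l : Z = X \/ Z = Y ->
  has_arc (contract B Z) p q l <->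
  exists u v, [/\ has_arc B u v l, p = contract_map Z u & q = contract_map Z v].
Proof.
move=> ZXY; rewrite has_arc_contract; split=> [] [u [v]].
  by case=> Buv _ -> ->; exists u, v.
case=> Buv -> ->; exists u, v; split=> //; apply/negP=> /andP[].
by case: ZXY => -> ? ?; case: clean_oriented => dir; have [? ?] := dir _ _ _ Buv;
  eauto using clean_disjoint.
Qed.

(** * The isomorphism *)

(** On vertices, the isomorphism: x in X goes to (x, x~), and y in Y to (y~, y). *)
Definition split_map (v : V) : option V * option V :=
  (contract_map Y v, contract_map X v).

Lemma split_map_inj : {in vset B &, injective split_map}.
Proof.
move=> u v Bu Bv []; rewrite /contract_map !clean_vset //.
by case: (u \in X); case: (v \in X) => /=; congruence.
Qed.

Lemma has_arc_contract_map (Z : {set V}) u v l : Z = X \/ Z = Y ->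
  has_arc B u v l ->
  has_arc (contract B Z) (contract_map Z u) (contract_map Z v) l.
Proof.
by move=> ZXY Buv; apply/(has_arc_contract_class _ _ _ ZXY); exists u, v.
Qed.

Lemma contract_synchronising (Z1 Z2 : {set V}) (a : arcT (contract B Z1)) :
  Z1 = X \/ Z1 = Y -> Z2 = X \/ Z2 = Y -> synchronising (contract B Z2) a.
Proof.
move=> Z1P Z2P.
have /(has_arc_contract_class _ _ _ Z1P)[u [v [Buv _ _]]] :
    has_arc (contract B Z1) (arc_tail a) (arc_head a) (lam a).
  by exists a; rewrite -surjective_pairing.
have [b [_ lam_b]] := has_arc_contract_map Z2P Buv.
by apply/existsP; exists b; apply/eqP.
Qed.

Lemma intermediate_arcsE p q l :
  has_arc (intermediate_product (contract B Y) (contract B X)) p q l <->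
  exists u v, [/\ has_arc B u v l, p = split_map u & q = split_map v].
Proof.
have [isX isY] : (X = X \/ X = Y) /\ (Y = X \/ Y = Y) by split; [left | right].
rewrite has_arc_intermediate; try by move=> a; apply: contract_synchronising.
split; last first.
  by case=> u [v [Buv -> ->]]; split; apply: has_arc_contract_map.
case: p q => p1 p2 [q1 q2] /= [].
case/(has_arc_contract_class _ _ _ isY) => u [v [Buv -> ->]].
case/(has_arc_contract_class _ _ _ isX) => u' [v' [Buv' -> ->]].
have [[Bu Bv] [Bu' Bv']] := (has_arc_vset Buv, has_arc_vset Buv').
case: clean_oriented => dir; have [uP vP] := dir _ _ _ Buv;
  have [uP' vP'] := dir _ _ _ Buv'.
(* Arcs from X to Y: cY keeps the tail u, and cX keeps the head v'. *)
  exists u, v'; split; first exact: clean_rectangle Buv Buv'.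
    by rewrite /split_map /contract_map uP uP'.
  by rewrite /split_map /contract_map vP vP' !ifN // -clean_vset.
exists u', v; split; first exact: clean_rectangle Buv' Buv.
  by rewrite /split_map /contract_map uP uP' !ifN // -clean_vset.
by rewrite /split_map /contract_map vP vP'.
Qed.

Lemma split_map_vset v : v \in vset B ->
  split_map v \in
    vset (intermediate_product (contract B Y) (contract B X)).
Proof. by move=> Bv; rewrite in_setX !contract_map_vset. Qed.

Hypothesis B_no_isolated : forall v, v \in vset B ->
  exists a : arcT B, arc_tail a = v \/ arc_head a = v.

Lemma vertex_tail_or_head v : v \in vset B ->
  (exists u l, has_arc B u v l) \/ (exists w l, has_arc B v w l).
Proof.
case/B_no_isolated=> a [<-|<-]; [right; exists (arc_head a) |
  left; exists (arc_tail a)]; exists (lam a), a; rewrite -surjective_pairing //.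
Qed.

(** An arc of the Cartesian product into the image of v comes from an arc of B
    whose head lies in the class of v, which is impossible when v is a tail. *)
Lemma split_map_cartesian_source v w l : has_arc B v w l ->
  forall p l',
    ~ has_arc (cartesian_product (contract B Y) (contract B X))
        p (split_map v) l'.
Proof.
move=> Bvw p l' Cpv; have [Bv _] := has_arc_vset Bvw.
have [u' [v' [l1 [Buv' same]]]] : exists u' v' l1, has_arc B u' v' l1 /\
    (v \in X) = (v' \in X).
  case/has_arc_cartesian: Cpv => /has_arc_contract_class;
    [case/(_ (or_intror erefl)) | case/(_ (or_introl erefl))];
    move=> u' [v' [Buv' _ /= eq_v]]; exists u', v', l'; split=> //;
    apply: contract_map_side => //; try (by case: (has_arc_vset Buv'));
    by [left | right].
have [_ Bv'] := has_arc_vset Buv'.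
case: clean_oriented => dir; have [vP _] := dir _ _ _ Bvw;
  have [_ vP'] := dir _ _ _ Buv'; move: vP vP'.
  by rewrite clean_vset // same => ->.
by rewrite clean_vset // same => /negbTE ->.
Qed.

(** A product vertex outside the image is (y~, x~) or some (x, y). *)
Lemma outside_image_cartesian_head q :
  q \in vset (intermediate_product (contract B Y) (contract B X)) ->
  q \notin split_map @: vset B ->
  exists p l,
    has_arc (cartesian_product (contract B Y) (contract B X)) p q l.
Proof.
have vsetE v : (v \in vset B) = (v \in X) || (v \in Y).
  by case: B_clean => [[_ _ _ <- _] _ _]; rewrite inE.
have memI v : v \in vset B -> split_map v \in split_map @: vset B.
  by move=> Bv; apply: imset_f.
have [isX isY] : (X = X \/ X = Y) /\ (Y = X \/ Y = Y) by split; [left | right].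
case: q => q1 q2; rewrite in_setX => /andP[q1P q2P] q'.
have left_head u v l : has_arc B u v l -> contract_map Y v = q1 ->
    exists p l, has_arc (cartesian_product (contract B Y) (contract B X))
      p (q1, q2) l.
  move=> Buv <-; exists (contract_map Y u, q2), l.
  by apply: has_arc_cartesian_left q2P; apply: has_arc_contract_map.
have right_head u v l : has_arc B u v l -> contract_map X v = q2 ->
    exists p l, has_arc (cartesian_product (contract B Y) (contract B X))
      p (q1, q2) l.
  move=> Buv <-; exists (q1, contract_map X u), l.
  by apply: has_arc_cartesian_right q1P; apply: has_arc_contract_map.
have some_vset (Z : {set V}) v : Some v \in vset (contract B Z) ->
    v \in vset B /\ v \notin Z.
  by rewrite !inE /= => /imsetP[w]; rewrite inE => /andP[? ?] [->].
case: q1 q2 q1P q2P q' left_head right_head => [x|] [y|] /= q1P q2P q' lh rh.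
- have [[Bx Y'x] [By X'y]] := (some_vset _ _ q1P, some_vset _ _ q2P).
  have Xx : x \in X by move: Y'x; rewrite clean_vset // negbK.
  have Yy : y \in Y by rewrite clean_vset.
  have [[u [l Bux]]|[w [l Bxw]]] := vertex_tail_or_head Bx.
    by apply: (lh _ _ _ Bux); rewrite /contract_map ifN.
  have [[u [l' Buy]]|[z [l' Byz]]] := vertex_tail_or_head By.
    by apply: (rh _ _ _ Buy); rewrite /contract_map ifN.
  case: clean_oriented => dir.
    by have [Xy _] := dir _ _ _ Byz; case: (clean_disjoint Xy Yy).
  by have [Yx _] := dir _ _ _ Bxw; case: (clean_disjoint Xx Yx).
- have [Bx Y'x] := some_vset _ _ q1P.
  have Xx : x \in X by move: Y'x; rewrite clean_vset // negbK.
  by case/negP: q'; have := memI x Bx; rewrite /split_map /contract_map Xx ifN.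
- have [By X'y] := some_vset _ _ q2P.
  have Yy : y \in Y by rewrite clean_vset.
  by case/negP: q'; have := memI y By; rewrite /split_map /contract_map Yy ifN.
- have [u [v [l Buv]]] : exists u v l, has_arc B u v l.
    case: B_clean => [[/set0Pn[x Xx] _ _ _ _] _ _].
    have Bx : x \in vset B by rewrite vsetE Xx.
    have [[u [l Bux]]|[w [l Bxw]]] := vertex_tail_or_head Bx.
      by exists u, x, l.
    by exists x, w, l.
  case: clean_oriented => dir; have [_ vP] := dir _ _ _ Buv.
    by apply: (lh _ _ _ Buv); rewrite /contract_map vP.
  by apply: (rh _ _ _ Buv); rewrite /contract_map vP.
Qed.

Lemma VRSP_contractE :
  vset (VRSP (contract B Y) (contract B X)) = split_map @: vset B /\
  forall p q l, has_arc (VRSP (contract B Y) (contract B X)) p q l <->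
    exists u v, [/\ has_arc B u v l, p = split_map u & q = split_map v].
Proof.
have [|||q qW|VE VP] := @VRSP_stable R _ _ (contract B Y) (contract B X)
  (split_map @: vset B).
- case: B_clean => [[/set0Pn[x Xx] _ _ BE _] _ _].
  apply/set0Pn; exists (split_map x); apply: split_map_vset.
  by rewrite -BE inE Xx.
- by apply/subsetP=> _ /imsetP[v Bv ->]; apply: split_map_vset.
- move=> _ /imsetP[v Bv ->].
  have [[u [l Buv]]|[w [l Bvw]]] := vertex_tail_or_head Bv; [right | left].
    exists (split_map u); first by apply: imset_f; case: (has_arc_vset Buv).
    by exists l; apply/intermediate_arcsE; exists u, v.
  exact: split_map_cartesian_source Bvw.
- case/setDP: qW => Iq W'q; split; last exact: outside_image_cartesian_head.
  move=> p l /intermediate_arcsE[u [v [Buv _ q_v]]]; case/negP: W'q.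
  by rewrite q_v imset_f //; case: (has_arc_vset Buv).
split=> // p q l; rewrite VP; split=> [[/intermediate_arcsE]//|].
case=> u [v [Buv -> ->]]; have [Bu Bv] := has_arc_vset Buv.
by split; [apply/intermediate_arcsE; exists u, v | exact: imset_f..].
Qed.

End Clean.

Theorem lemma6p1 (R : realType) (V : finType) (B : graph R V) (X Y : {set V})
    (B_acyclic : acyclic B)
    (B_clean : clean_bipartite B X Y)
    (B_no_isolated : forall v, v \in vset B ->
       exists a : arcT B, arc_tail a = v \/ arc_head a = v) :
  isomorphic B (VRSP (contract B Y) (contract B X)).
Proof.
have [VE VP] := VRSP_contractE B_clean B_no_isolated.
have in_V (v : {v | v \in vset B}) :
    split_map X Y (val v) \in vset (VRSP (contract B Y) (contract B X)).
  by rewrite VE imset_f //; exact: (valP v).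
pose phi v : {w | w \in vset (VRSP (contract B Y) (contract B X))} :=
  exist _ (split_map X Y (val v)) (in_V v).
exists phi; split.
  apply: inj_card_bij => [u v /(congr1 val) /= eq_uv|].
    apply/val_inj; apply: split_map_inj B_clean _ _ _ _ eq_uv; exact: valP.
  by rewrite !card_sig VE; apply: leq_imset_card.
move=> u v l; rewrite -/(has_arc _ _ _ _) -/(has_arc _ _ _ _) VP /=.
split=> [Buv|[u' [v' [Buv /= eq_u eq_v]]]].
  by exists (val u), (val v).
have [Bu' Bv'] := has_arc_vset Buv.
rewrite (split_map_inj B_clean (valP u) Bu' eq_u).
by rewrite (split_map_inj B_clean (valP v) Bv' eq_v).
Qed.
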